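(* Let $n\ge1$. Every prime ideal $\mathfrak p$ of $\mathbb{S}_n$ can be written uniquely in the form $\mathfrak p=\mathbb{S}_{\mathcal N}\otimes\pi_{C\mathcal N}^{-1}(\mathfrak q)$, where $\mathcal N\subseteq\{1,\dots,n\}$ and $\mathfrak q$ is a prime ideal of $L_{C\mathcal N}$. Conversely, every ideal of this form is prime. Thus $\mathrm{Spec}(\mathbb{S}_n)=\coprod_{\mathcal N\subseteq\{1,\dots,n\}}\mathrm{Spec}(\mathbb{S}_n,\mathcal N)$, a disjoint union, where \[ \mathrm{Spec}(\mathbb{S}_n,\mathcal N)=\{\mathbb{S}_{\mathcal N}\otimes\pi_{C\mathcal N}^{-1}(\mathfrak q)\mid\mathfrak q\in\mathrm{Spec}(L_{C\mathcal N})\}. \]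
   Context: $K$ is a field. $\mathbb{S}_n$ is the $K$-algebra generated by $x_1,\dots,x_n,y_1,\dots,y_n$ subject to the defining relations $y_ix_i=1$ for all $i$, and $[x_i,y_j]=[x_i,x_j]=[y_i,y_j]=0$ for all $i\ne j$. For each $i$, $\mathbb{S}_1(i)$ is the subalgebra generated by $x_i,y_i$, and $\mathbb{S}_n=\mathbb{S}_1(1)\otimes\cdots\otimes\mathbb{S}_1(n)$. $F(i)=\bigoplus_{k,l\in\mathbb N}K(x_i^ky_i^l-x_i^{k+1}y_i^{l+1})$, an ideal of $\mathbb{S}_1(i)$ with $\mathbb{S}_1(i)/F(i)\cong K[x_i,x_i^{-1}]$ via $x_i\mapsto x_i$, $y_i\mapsto x_i^{-1}$. For $\mathcal N\subseteq\{1,\dots,n\}$, let $C\mathcal N$ be its complement and define: - $\mathbb{S}_{\mathcal N}=\bigotimes_{i\in\mathcal N}\mathbb{S}_1(i)$ (equal to $K$ if $\mathcal N=\emptyset$), so $\mathbb{S}_n=\mathbb{S}_{\mathcal N}\otimes\mathbb{S}_{C\mathcal N}$; - $L_{\mathcal N}=K[x_i,x_i^{-1}:i\in\mathcal N]$; - $\mathfrak a_{\mathcal N}=\sum_{i\in\mathcal N}\big(F(i)\otimes\bigotimes_{j\in\mathcal N\setminus\{i\}}\mathbb{S}_1(j)\big)$, an ideal of $\mathbb{S}_{\mathcal N}$; - $\pi_{\mathcal N}:\mathbb{S}_{\mathcal N}\to\mathbb{S}_{\mathcal N}/\mathfrak a_{\mathcal N}\cong L_{\mathcal N}$ the canonical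 epimorphism. Prime ideals are proper by convention. *)

(* Defs.v *)
From HB Require Import structures.
From mathcomp Require Import all_boot all_order all_algebra.
Set Implicit Arguments. Unset Strict Implicit. Unset Printing Implicit Defensive.
Import Order.TTheory GRing.Theory Num.Theory.
Local Open Scope ring_scope.

(* Monoid algebras K[M] encoded by formal sums.                            *)
(* An element of K[M] is represented by a finite list of terms (c, m),     *)
(* meaning  sum c * m ; two lists represent the same element iff they have *)
(* the same coefficient function (fequiv).  Subsets of the algebra (ideals)*)
(* are predicates on lists that are saturated for fequiv.                  *)
Section FSum.
Variables (K : fieldType) (M : eqType) (mmul : M -> M -> M).

Definition fsum := seq (K * M).

Definition coef (s : fsum) (m : M) : K :=
  \sum_(p <- s) (if p.2 == m then p.1 else 0).

Definition fequiv (s t : fsum) : Prop := forall m, coef s m = coef t m.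

(* sum is concatenation, scalar action and product (bilinear extension    *)
(* of the monoid product)                                                 *)
Definition fscale (c : K) (s : fsum) : fsum := [seq (c * p.1, p.2) | p <- s].
Definition fmul (s t : fsum) : fsum :=
  [seq (p.1 * q.1, mmul p.2 q.2) | p <- s, q <- t].

Definition in_sub (P : pred M) (s : fsum) : Prop :=
  forall m, coef s m != 0 -> P m.

Definition is_ideal (P : pred M) (I : fsum -> Prop) : Prop :=
  (forall s, I s -> in_sub P s) /\
  (forall s t, I s -> fequiv s t -> I t) /\
  I [::] /\
  (forall s t, I s -> I t -> I (s ++ t)) /\
  (forall c s, I s -> I (fscale c s)) /\
  (forall a s, in_sub P a -> I s -> I (fmul a s) /\ I (fmul s a)).

Definition is_prime (P : pred M) (I : fsum -> Prop) : Prop :=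
  is_ideal P I /\
  (exists s, in_sub P s /\ ~ I s) /\
  (forall J1 J2, is_ideal P J1 -> is_ideal P J2 ->
     (forall a b, J1 a -> J2 b -> I (fmul a b)) ->
     (forall a, J1 a -> I a) \/ (forall b, J2 b -> I b)).

End FSum.

(* The algebra S_n = K[B^n], B the bicyclic monoid: the monomial           *)
(* m : 'I_n -> nat * nat stands for  prod_i x_i^(m i).1 y_i^(m i).2,        *)
(* and  (x^a y^b)(x^c y^d) = x^(a + (c-b)) y^(d + (b-c))  since y x = 1.    *)
Definition smon (n : nat) := {ffun 'I_n -> nat * nat}.

Definition bmul (u v : nat * nat) : nat * nat :=
  ((u.1 + (v.1 - u.2))%N, (v.2 + (u.2 - v.1))%N).

Definition smul (n : nat) (m1 m2 : smon n) : smon n :=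
  [ffun i => bmul (m1 i) (m2 i)].

(* S_A (A a subset of indices), embedded in S_n: monomials trivial off A *)
Definition Ssupp (n : nat) (A : {set 'I_n}) : pred (smon n) :=
  fun m => [forall i, (i \notin A) ==> (m i == (0%N, 0%N))].

(* L_A = K[x_i, x_i^-1 : i in A], embedded in L_{1..n}: monomials are     *)
(* exponent vectors 'I_n -> int vanishing off A                           *)
Definition lmon (n : nat) := {ffun 'I_n -> int}.
Definition lmul (n : nat) (m1 m2 : lmon n) : lmon n := [ffun i => m1 i + m2 i].
Definition Lsupp (n : nat) (A : {set 'I_n}) : pred (lmon n) :=
  fun m => [forall i, (i \notin A) ==> (m i == 0)].

(* pi_A : S_A -> S_A / a_A = L_A, x_i |-> x_i, y_i |-> x_i^-1 *)
Definition pimon (n : nat) (m : smon n) : lmon n :=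
  [ffun i => ((m i).1%:Z - (m i).2%:Z)].
Definition piS (K : fieldType) (n : nat) (s : fsum K (smon n))
  : fsum K (lmon n) := [seq (p.1, pimon p.2) | p <- s].

Definition pi_preim (K : fieldType) (n : nat) (A : {set 'I_n})
  (q : fsum K (lmon n) -> Prop) (s : fsum K (smon n)) : Prop :=
  in_sub (Ssupp A) s /\ q (piS s).

(* S_N (x) J  inside  S_n = S_N (x) S_{CN}  (J an ideal of S_{CN}):        *)
(* the elements  sum_k a_k b_k  with a_k in S_N and b_k in J               *)
Definition tensor_ideal (K : fieldType) (n : nat) (N : {set 'I_n})
  (J : fsum K (smon n) -> Prop) (s : fsum K (smon n)) : Prop :=
  exists ps : seq (fsum K (smon n) * fsum K (smon n)),
    (forall p, p \in ps -> in_sub (Ssupp N) p.1 /\ J p.2) /\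
    fequiv s (flatten [seq fmul (@smul n) p.1 p.2 | p <- ps]).

Definition Sprime (K : fieldType) (n : nat) (p : fsum K (smon n) -> Prop) :=
  is_prime (@smul n) predT p.
Definition Lprime (K : fieldType) (n : nat) (A : {set 'I_n})
  (q : fsum K (lmon n) -> Prop) := is_prime (@lmul n) (Lsupp A) q.

Definition Spart (K : fieldType) (n : nat) (N : {set 'I_n})
  (q : fsum K (lmon n) -> Prop) : fsum K (smon n) -> Prop :=
  tensor_ideal N (pi_preim (~: N) q).

(* Main.v *)
Require Import Defs.
From HB Require Import structures.
From mathcomp Require Import all_boot all_order all_algebra.
From mathcomp Require Import zify ring.
From Stdlib Require Import Classical.
Set Implicit Arguments. Unset Strict Implicit. Unset Printing Implicit Defensive.
Import Order.TTheory GRing.Theory Num.Theory.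
Local Open Scope ring_scope.

(* A prime p of S_n determines N, the set of i with 1 - x_i y_i not in p; modulo
   p the variables outside N become invertible and central.  S_N acts on
   K[x_i : i in N] (the bicyclic monoid acting on N), and the matrix coefficients
   Phi_(k,l) : S_n -> L_CN of this action separate S_N (x) L_CN.  The idempotent
   E = prod_(i in N) (1 - x_i y_i) satisfies E y^k s x^l E = E Phi_(k,l)(s) mod p
   and is not in p, so primality puts the coefficients of elements of p in the
   contraction q of p to L_CN; this gives p = S_N (x) pi^-1(q).  Conversely the
   matrix units x^l E y^k turn a product of ideals lying in S_N (x) pi^-1(q) into
   products of matrix coefficients lying in q. *)

(** The ideal F(i) has the matrix units x_i^k (1 - x_i y_i) y_i^l, so it is generated by 1 - x_i
    y_i, and this one element decides whether a prime contains F(i). Two obstacles shape the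
    argument. Membership in S_N (x) pi^-1(q) is an existential statement about sums of tensors, of
    little use for proving non-membership; it is replaced by the condition that all matrix
    coefficients lie in q. Secondly, primality speaks of products of ideals, so from a b in p one
    needs a S_n b inside p before a factor can be split off. This is available in two situations:
    between 1 - x_i y_i and an idempotent in other directions, because y e = 0 = e x for e = 1 - x
    y, and next to lifts of elements of L_CN, which are central modulo p. No quotient S_n / p is
    formed: L_CN is compared with it through a linear section of pi that is multiplicative only
    modulo p. *)

Definition fmap (K : fieldType) (X Y : eqType) (h : X -> Y) (s : fsum K X) :
  fsum K Y := [seq (p.1, h p.2) | p <- s].

Definition frestr (K : fieldType) (X : eqType) (C : pred X) (s : fsum K X) :
  fsum K X := [seq p <- s | C p.2].

Definition fdiff (K : fieldType) (X : eqType) (s t : fsum K X) : fsum K X :=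
  s ++ fscale (-1) t.

(** * Formal sums seen through linear functionals *)

Section Evaluation.
Variables (K : fieldType) (M : eqType).
Implicit Types (s t : fsum K M) (f g : M -> K) (P C : pred M).

(* Two formal sums are equivalent iff no linear functional separates them, so
   every identity in a monoid algebra is proved by evaluating functionals. *)
Definition ev f s : K := \sum_(p <- s) p.1 * f p.2.

Lemma ev_nil f : ev f [::] = 0.
Proof. by rewrite /ev big_nil. Qed.

Lemma ev_cons f p s : ev f (p :: s) = p.1 * f p.2 + ev f s.
Proof. by rewrite /ev big_cons. Qed.

Lemma ev_cat f s t : ev f (s ++ t) = ev f s + ev f t.
Proof. by rewrite /ev big_cat. Qed.

Lemma ev_scale f c s : ev f (fscale c s) = c * ev f s.
Proof.
by rewrite /ev big_map mulr_sumr; apply: eq_bigr => p _; rewrite mulrA.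
Qed.

Lemma ev_diff f s t : ev f (fdiff s t) = ev f s - ev f t.
Proof. by rewrite ev_cat ev_scale mulN1r. Qed.

Lemma ev_restr f C s :
  ev f (frestr C s) = ev (fun m => if C m then f m else 0) s.
Proof.
rewrite /ev big_filter big_mkcond; apply: eq_bigr => p _.
by case: (C p.2); rewrite ?mulr0.
Qed.

Lemma ev_congr f g s : {in s, forall p, f p.2 = g p.2} -> ev f s = ev g s.
Proof. by move=> fg; apply: eq_big_seq => p ps; rewrite (fg p ps). Qed.

Lemma eq_ev f g s : f =1 g -> ev f s = ev g s.
Proof. by move=> fg; apply: ev_congr => p _. Qed.

Lemma ev0 s : ev (fun=> 0) s = 0.
Proof. by rewrite /ev big1 // => p _; rewrite mulr0. Qed.

Lemma ev_mulf c f s : ev (fun m => c * f m) s = c * ev f s.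
Proof. by rewrite /ev mulr_sumr; apply: eq_bigr => p _; rewrite mulrCA. Qed.

Lemma ev_if (b : bool) f s :
  ev (fun m => if b then f m else 0) s = if b then ev f s else 0.
Proof. by case: b; rewrite ?ev0. Qed.

Lemma coefE s m : coef s m = ev (fun x => if x == m then 1 else 0) s.
Proof.
by apply: eq_bigr => p _; case: (p.2 == m); rewrite ?mulr1 ?mulr0.
Qed.

Lemma ev_coef f s (r : seq M) : uniq r -> {subset [seq p.2 | p <- s] <= r} ->
  ev f s = \sum_(m <- r) coef s m * f m.
Proof.
move=> ur; elim: s => [|p s IH] sr.
  by rewrite ev_nil big1 // => m _; rewrite /coef big_nil mul0r.
rewrite ev_cons IH; last by move=> m ms; apply: sr; rewrite inE ms orbT.
under [RHS]eq_bigr => m _ do rewrite /coef big_cons -/(coef s m) mulrDl.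
rewrite big_split /=; congr (_ + _).
rewrite (bigD1_seq p.2) //=; last by apply: sr; rewrite inE eqxx.
by rewrite eqxx big1 ?addr0 // => m /negPf; rewrite eq_sym => ->; rewrite mul0r.
Qed.

Lemma fequivP s t : fequiv s t <-> forall f, ev f s = ev f t.
Proof.
split=> [st f|st m]; last by rewrite !coefE st.
pose r := undup [seq p.2 | p <- s ++ t].
have ur : uniq r by exact: undup_uniq.
rewrite (ev_coef f ur) ?(ev_coef (s := t) f ur).
- by apply: eq_bigr => m _; rewrite st.
- by move=> m; rewrite mem_undup map_cat mem_cat => ->; rewrite orbT.
by move=> m; rewrite mem_undup map_cat mem_cat => ->.
Qed.

Lemma fequiv_sym s t : fequiv s t -> fequiv t s.
Proof. by move=> st m; rewrite st. Qed.

(** A list may contain monomials outside P whose coefficients cancel, so a termwise comparison is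
    not possible; collecting coefficients removes them. *)
Lemma ev_in_sub P f g s : in_sub P s -> (forall m, P m -> f m = g m) ->
  ev f s = ev g s.
Proof.
move=> Ps fg; pose r := undup [seq p.2 | p <- s].
have sr : {subset [seq p.2 | p <- s] <= r} by move=> m; rewrite mem_undup.
rewrite (ev_coef f (undup_uniq _) sr) (ev_coef g (undup_uniq _) sr).
apply: eq_bigr => m _; have [->|/Ps /fg -> //] := eqVneq (coef s m) 0.
by rewrite !mul0r.
Qed.

Lemma in_subP P s :
  in_sub P s <-> forall f, (forall m, P m -> f m = 0) -> ev f s = 0.
Proof.
split=> [Ps f f0|H m].
  by rewrite (ev_in_sub (g := fun=> 0) Ps) ?ev0.
apply: contraNT => Pm; apply/eqP; rewrite coefE H // => x Px.
by have [xm|//] := eqVneq x m; rewrite xm (negPf Pm) in Px.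
Qed.

Lemma in_sub_eq P s t : fequiv s t -> in_sub P s -> in_sub P t.
Proof. by move=> st Ps m; rewrite -st; exact: Ps. Qed.

Lemma in_sub_all P s : {in s, forall p, P p.2} -> in_sub P s.
Proof.
move=> Ps; apply/in_subP => f f0; rewrite -[RHS](ev0 s).
by apply: ev_congr => p /Ps /f0.
Qed.

Lemma in_sub_cat P s t : in_sub P s -> in_sub P t -> in_sub P (s ++ t).
Proof.
by move=> /in_subP Ps /in_subP Pt; apply/in_subP => f f0;
  rewrite ev_cat Ps ?Pt ?addr0.
Qed.

Lemma in_sub_scale P c s : in_sub P s -> in_sub P (fscale c s).
Proof.
by move=> /in_subP Ps; apply/in_subP => f f0; rewrite ev_scale Ps ?mulr0.
Qed.

Lemma frestr_id P s : in_sub P s -> fequiv (frestr P s) s.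
Proof.
move=> Ps; apply/fequivP => f; rewrite ev_restr.
by apply: (ev_in_sub Ps) => m ->.
Qed.

End Evaluation.

Section Maps.
Variables (K : fieldType) (X Y : eqType).

Lemma ev_map (h : X -> Y) (f : Y -> K) s : ev f (fmap h s) = ev (f \o h) s.
Proof. by rewrite /ev big_map. Qed.

Lemma fmap_eq (h : X -> Y) (s t : fsum K X) :
  fequiv s t -> fequiv (fmap h s) (fmap h t).
Proof. by move=> /fequivP st; apply/fequivP => f; rewrite !ev_map st. Qed.

End Maps.

(** * Ideals of monoid algebras and primality tested on elements *)

Section Ideals.
Variables (K : fieldType) (M : eqType) (mmul : M -> M -> M) (P : pred M).
Implicit Types (s t a : fsum K M) (I : fsum K M -> Prop).
Local Notation mul := (fmul mmul).

Lemma ev_mul f s t :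
  ev f (mul s t) = ev (fun m => ev (fun m' => f (mmul m m')) t) s.
Proof.
rewrite /ev /fmul big_allpairs_dep; apply: eq_bigr => p _ /=.
by rewrite mulr_sumr; apply: eq_bigr => q _; rewrite mulrA.
Qed.

Lemma fmul_eq s s' t t' : fequiv s s' -> fequiv t t' ->
  fequiv (mul s t) (mul s' t').
Proof.
move=> /fequivP ss /fequivP tt; apply/fequivP => f; rewrite !ev_mul ss.
by apply: eq_ev => m; rewrite tt.
Qed.

Lemma ev_add (f g : M -> K) s : ev (fun m => f m + g m) s = ev f s + ev g s.
Proof. by rewrite /ev -big_split; apply: eq_bigr => p _; rewrite mulrDr. Qed.

Lemma fmul_catr s t a : fequiv (mul a (s ++ t)) (mul a s ++ mul a t).
Proof.
apply/fequivP => f; rewrite ev_cat !ev_mul -ev_add.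
by apply: eq_ev => m; rewrite ev_cat.
Qed.

Lemma fmul_scaler c s a : fequiv (mul a (fscale c s)) (fscale c (mul a s)).
Proof.
apply/fequivP => f; rewrite ev_scale !ev_mul -ev_mulf.
by apply: eq_ev => m; rewrite ev_scale.
Qed.

Lemma fmul_catl s t a : mul (s ++ t) a = mul s a ++ mul t a.
Proof. by rewrite /fmul allpairs_cat. Qed.

Lemma fmul_scalel c s a : fequiv (mul (fscale c s) a) (fscale c (mul s a)).
Proof. by apply/fequivP => f; rewrite ev_scale !ev_mul ev_scale. Qed.

Hypothesis mulP : forall m m', P m -> P m' -> P (mmul m m').

Lemma in_sub_mul s t : in_sub P s -> in_sub P t -> in_sub P (mul s t).
Proof.
move=> Ps Pt; apply/in_subP => f f0; rewrite ev_mul -[RHS](ev0 s).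
apply: (ev_in_sub Ps) => m Pm; rewrite -[RHS](ev0 t).
by apply: (ev_in_sub Pt) => m' Pm'; apply/f0/mulP.
Qed.

Section Closure.
Variable I : fsum K M -> Prop.
Hypothesis idI : is_ideal mmul P I.

Lemma ideal_sub s : I s -> in_sub P s. Proof. by case: idI => H _; exact: H. Qed.
Lemma ideal_eq s t : fequiv s t -> I s -> I t.
Proof. by case: idI => _ [H _] st Is; exact: H Is st. Qed.
Lemma ideal_nil : I [::]. Proof. by case: idI => _ [_ []]. Qed.
Lemma ideal_cat s t : I s -> I t -> I (s ++ t).
Proof. by case: idI => _ [_ [_ [H _]]]; exact: H. Qed.
Lemma ideal_scale c s : I s -> I (fscale c s).
Proof. by case: idI => _ [_ [_ [_ [H _]]]]; exact: H. Qed.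
Lemma ideal_mull a s : in_sub P a -> I s -> I (mul a s).
Proof. by case: idI => _ [_ [_ [_ [_ H]]]] Pa Is; case: (H a s Pa Is). Qed.
Lemma ideal_mulr a s : in_sub P a -> I s -> I (mul s a).
Proof. by case: idI => _ [_ [_ [_ [_ H]]]] Pa Is; case: (H a s Pa Is). Qed.

Lemma ideal_diff s t : I (fdiff s t) -> I t -> I s.
Proof.
move=> Ist It; apply: (ideal_eq _ (ideal_cat Ist It)).
by apply/fequivP => f; rewrite ev_cat ev_diff subrK.
Qed.

End Closure.

Hypothesis mulA : associative mmul.
Variable e : M.
Hypothesis mul1 : left_id e mmul.
Hypothesis Pe : P e.

Lemma fmulA s t a : fequiv (mul s (mul t a)) (mul (mul s t) a).
Proof.
apply/fequivP => f; rewrite !ev_mul; apply: eq_ev => m; rewrite ev_mul.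
by apply: eq_ev => m'; apply: eq_ev => m''; rewrite mulA.
Qed.

Lemma ideal_sandwich I a b : is_ideal mmul P I -> in_sub P a -> in_sub P b ->
  (forall m, P m -> I (mul (mul a [:: (1, m)]) b)) ->
  forall r, in_sub P r -> I (mul (mul a r) b).
Proof.
move=> idI Pa Pb H r Pr.
apply: (ideal_eq idI (s := mul (mul a (frestr P r)) b)).
  by apply/fmul_eq => //; apply/fmul_eq => //; exact: frestr_id.
elim: r {Pr} => [|p r IH] /=.
  apply: (ideal_eq idI _ (ideal_nil idI)).
  apply/fequivP => f; rewrite !ev_mul ev_nil -[LHS](ev0 a).
  by apply: eq_ev => m; rewrite ev_nil.
rewrite /frestr /=; case: ifP => // Pp.
apply: (ideal_eq idI _ (ideal_cat idI (ideal_scale idI p.1 (H _ Pp)) IH)).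
apply/fequivP => f; rewrite ev_cat ev_scale !ev_mul -ev_mulf -ev_add.
apply: eq_ev => m; rewrite !ev_cons ev_nil /frestr /=; ring.
Qed.

(** Instead of the ideals generated by a and b, the proof uses two annihilators: [J2] is the set of
    t with a r t in I for all r, and [J1] the set of s with s [J2] inside I. Being two-sided ideals
    is immediate for them, and no finite sums of products have to be handled. *)
Lemma prime_elements I a b : is_prime mmul P I -> in_sub P a -> in_sub P b ->
  (forall m, P m -> I (mul (mul a [:: (1, m)]) b)) -> I a \/ I b.
Proof.
move=> [idI [_ prI]] Pa Pb H0; have H := ideal_sandwich idI Pa Pb H0.
pose J2 t := in_sub P t /\ forall r, in_sub P r -> I (mul (mul a r) t).
pose J1 s := in_sub P s /\ forall t, J2 t -> I (mul s t).
have J2b : J2 b by split.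
have P1 : in_sub P [:: (1 : K, e)].
  by apply: in_sub_all => p; rewrite inE => /eqP ->.
have J1a : J1 a.
  split=> // t [Pt /(_ _ P1)]; apply: (ideal_eq idI); apply/fequivP => f.
  rewrite !ev_mul; apply: eq_ev => m; rewrite ev_cons ev_nil mul1r addr0.
  by apply: eq_ev => m'; rewrite -mulA mul1.
have iJ2 : is_ideal mmul P J2.
  split; first by move=> ? [].
  split=> [s t [Ps Is] st|].
    split=> [|r Pr]; first exact: in_sub_eq st Ps.
    by apply: (ideal_eq idI) (Is r Pr); apply: fmul_eq.
  split; first split=> [m|r Pr]; first by rewrite /coef big_nil eqxx.
    apply: (ideal_eq idI _ (ideal_nil idI)); apply/fequivP => f.
    by rewrite ev_nil ev_mul -[LHS](ev0 (mul a r)); apply: eq_ev => m; rewrite ev_nil.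
  split=> [s t [Ps Is] [Pt It]|].
    split=> [|r Pr]; first exact: in_sub_cat.
    apply: (ideal_eq idI _ (ideal_cat idI (Is _ Pr) (It _ Pr))).
    exact/fequiv_sym/fmul_catr.
  split=> [c s [Ps Is]|].
    split=> [|r Pr]; first exact: in_sub_scale.
    apply: (ideal_eq idI _ (ideal_scale idI c (Is _ Pr))).
    exact/fequiv_sym/fmul_scaler.
  move=> c s Pc [Ps Is]; split; split; try exact: in_sub_mul.
    move=> r Pr; apply: (ideal_eq idI _ (Is _ (in_sub_mul Pr Pc))).
    move=> m; rewrite [RHS]fmulA; apply: fmul_eq => // {}m; exact: fmulA.
  move=> r Pr; apply: (ideal_eq idI _ (ideal_mulr idI Pc (Is _ Pr))).
  exact/fequiv_sym/fmulA.
have iJ1 : is_ideal mmul P J1.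
  split; first by move=> ? [].
  split=> [s t [Ps Is] st|].
    split=> [|r Pr]; first exact: in_sub_eq st Ps.
    by apply: (ideal_eq idI) (Is r Pr); apply: fmul_eq.
  split; first split=> [m|r Pr]; first by rewrite /coef big_nil eqxx.
    exact: ideal_nil idI.
  split=> [s t [Ps Is] [Pt It]|].
    split=> [|r Pr]; first exact: in_sub_cat.
    rewrite fmul_catl; exact (ideal_cat idI (Is _ Pr) (It _ Pr)).
  split=> [c s [Ps Is]|].
    split=> [|r Pr]; first exact: in_sub_scale.
    apply: (ideal_eq idI _ (ideal_scale idI c (Is _ Pr))).
    exact/fequiv_sym/fmul_scalel.
  move=> c s Pc [Ps Is]; split; split; try exact: in_sub_mul.
    move=> r Jr; apply: (ideal_eq idI _ (ideal_mull idI Pc (Is _ Jr))).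
    exact: fmulA.
  move=> r Jr; have Jcr : J2 (mul c r).
    by case: iJ2 => _ [_ [_ [_ [_ H2]]]]; case: (H2 c r Pc Jr).
  apply: (ideal_eq idI _ (Is _ Jcr)); exact: fmulA.
by case: (prI J1 J2 iJ1 iJ2 (fun s t Js Jt => Js.2 t Jt)) => HI; [left|right]; apply: HI.
Qed.

End Ideals.

(** Groups the terms of s by their key. Only three closure properties of I are asked for, so that
    the lemma applies to [Spart] before it is known to be an ideal. *)
Lemma fibre_sum (K : fieldType) (X Y V : eqType) (I : fsum K Y -> Prop)
    (h : X -> Y) (key : X -> V) (C : pred V) (s : fsum K X) :
  (forall t u, fequiv t u -> I t -> I u) -> I [::] ->
  (forall t u, I t -> I u -> I (t ++ u)) ->
  (forall m, C (key m) -> I (fmap h (frestr (fun x => key x == key m) s))) ->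
  I (fmap h (frestr (C \o key) s)).
Proof.
move=> Ieq Inil Icat H.
pose r := undup [seq key p.2 | p <- frestr (C \o key) s].
have Hr v : v \in r -> exists2 m, v = key m & C v.
  rewrite mem_undup => /mapP[p]; rewrite mem_filter => /andP[Cp _] ->.
  by exists p.2.
have ur : uniq r by exact: undup_uniq.
have -> : frestr (C \o key) s = frestr (fun m => key m \in r) s.
  apply: eq_in_filter => p ps; apply/idP/idP => /= [Cp|/Hr[m -> //]].
  by rewrite mem_undup; apply/mapP; exists p => //; rewrite mem_filter /= Cp.
elim: r ur Hr => [_ _|v r IH /=/andP[vr ur] Hr].
  by rewrite /frestr filter_pred0.
have [m vm Cv] := Hr v (mem_head _ _).
have Iv : I (fmap h (frestr (fun x => key x == v) s)).
  by rewrite vm; apply: H; rewrite -vm.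
have {}IH := IH ur (fun w wr => Hr w (mem_behead (s := v :: r) wr)).
apply: (Ieq _ _ _ (Icat _ _ Iv IH)); apply/fequivP => f.
rewrite ev_cat !ev_map !ev_restr /ev -big_split; apply: eq_bigr => p _ /=.
rewrite -mulrDr; congr (_ * _); rewrite inE.
by case: eqP => [->|]; rewrite ?(negPf vr) ?addr0 ?add0r.
Qed.

(** * Monomials, their action in the directions of N, and their images in L_CN *)

Section Monomials.
Variable n : nat.
Implicit Types (N : {set 'I_n}) (m u v : smon n) (z : lmon n) (k l : 'I_n -> nat).

Lemma forall_andb (A B : pred 'I_n) :
  [forall i, A i && B i] = [forall i, A i] && [forall i, B i].
Proof.
apply/forallP/andP => [H|[/forallP HA /forallP HB] i]; last by rewrite HA HB.
by split; apply/forallP => i; case/andP: (H i).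
Qed.

Definition sone : smon n := [ffun => (0%N, 0%N)].
Definition lone : lmon n := [ffun => 0].

Lemma smulA : associative (@smul n).
Proof.
move=> a b c; apply/ffunP => i; rewrite !ffunE /bmul /=.
by case: (a i) (b i) (c i) => ? ? [? ?] [? ?] /=; congr (_, _); lia.
Qed.

Lemma smul1 : left_id sone (@smul n).
Proof.
move=> a; apply/ffunP => i; rewrite !ffunE /bmul /=.
by case: (a i) => ? ? /=; congr (_, _); lia.
Qed.

Lemma lmulA : associative (@lmul n).
Proof. by move=> a b c; apply/ffunP => i; rewrite !ffunE addrA. Qed.

Lemma lmulC : commutative (@lmul n).
Proof. by move=> a b; apply/ffunP => i; rewrite !ffunE addrC. Qed.

Lemma lmul1 : left_id lone (@lmul n).
Proof. by move=> a; apply/ffunP => i; rewrite !ffunE add0r. Qed.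

Lemma Lsupp_mul N z z' : Lsupp N z -> Lsupp N z' -> Lsupp N (lmul z z').
Proof.
move=> /forallP Hz /forallP Hz'; apply/forallP => i; apply/implyP => iN.
by rewrite ffunE (eqP (implyP (Hz i) iN)) (eqP (implyP (Hz' i) iN)) addr0.
Qed.

Lemma Lsupp1 N : Lsupp N lone.
Proof. by apply/forallP => i; rewrite ffunE eqxx implybT. Qed.

(* The bicyclic monoid acts on basis vectors e_0, e_1, ... by
   y e_0 = 0, y e_(l+1) = e_l, x e_l = e_(l+1); [actc u l k] says u e_l = e_k. *)
Definition actc (u : nat * nat) (l k : nat) : bool :=
  (u.2 <= l)%N && (u.1 + (l - u.2) == k)%N.

Definition acts N m l k : bool :=
  [forall i, (i \in N) ==> actc (m i) (l i) (k i)].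

Definition leN N k l : bool := [forall i, (i \in N) ==> (k i <= l i)%N].

Definition pC N m : lmon n :=
  [ffun i => if i \in N then 0 else (m i).1%:Z - (m i).2%:Z].

Definition restr N m : smon n := [ffun i => if i \in N then m i else (0%N, 0%N)].

Lemma pC_mul N m m' : pC N (smul m m') = lmul (pC N m) (pC N m').
Proof.
apply/ffunP => i; rewrite !ffunE; case: (i \in N); rewrite ?addr0 //.
by rewrite /bmul; case: (m i) (m' i) => ? ? [? ?] /=; lia.
Qed.

Lemma pC1 N : pC N sone = lone.
Proof. by apply/ffunP => i; rewrite !ffunE subrr if_same. Qed.

Lemma pC_supp N m : Lsupp (~: N) (pC N m).
Proof.
by apply/forallP => i; rewrite inE negbK ffunE; case: (i \in N).
Qed.

(** A monomial acts as a partial injection on the basis, so the intermediate vector of a product is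
    determined by the target k alone (here), or by the source l alone ([acts_mulr]). Matrix products
    therefore need no sum over a middle index. *)
Lemma acts_mul N m m' l k : acts N (smul m m') l k =
  leN N (fun i => (m i).1) k &&
  acts N m' l (fun i => (m i).2 + (k i - (m i).1))%N.
Proof.
rewrite -forall_andb; apply: eq_forallb => i; rewrite ffunE.
case: (i \in N) => //=; rewrite /actc /bmul.
by case: (m i) (m' i) => ? ? [? ?] /=; lia.
Qed.

Lemma acts_mulr N m m' l k : acts N (smul m m') l k =
  leN N (fun i => (m' i).2) l &&
  acts N m (fun i => (m' i).1 + (l i - (m' i).2))%N k.
Proof.
rewrite -forall_andb; apply: eq_forallb => i; rewrite ffunE.
case: (i \in N) => //=; rewrite /actc /bmul.
by case: (m i) (m' i) => ? ? [? ?] /=; lia.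
Qed.

Lemma acts_restr N m l k : acts N (restr N m) l k = acts N m l k.
Proof.
by apply: eq_forallb => i; rewrite ffunE; case: (i \in N).
Qed.

Lemma acts_ext N m l l' k k' : {in N, l =1 l'} -> {in N, k =1 k'} ->
  acts N m l k = acts N m l' k'.
Proof.
move=> ll kk; apply: eq_forallb => i.
by case iN: (i \in N) => //=; rewrite ll ?kk.
Qed.

Definition xy (i : 'I_n) : smon n :=
  [ffun j => if j == i then (1%N, 1%N) else (0%N, 0%N)].

Lemma pC_xy N i : pC N (xy i) = lone.
Proof.
by apply/ffunP => j; rewrite !ffunE; case: (j == i); rewrite subrr if_same.
Qed.

End Monomials.

(** * Matrix coefficients and faithfulness *)

Section Coefficients.
Variables (K : fieldType) (n : nat).
Implicit Types (N : {set 'I_n}) (m : smon n) (k l : 'I_n -> nat).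
Implicit Types (g : lmon n -> K) (s t : fsum K (smon n)).
Local Notation "s ** t" := (fmul (@smul n) s t) (at level 40, left associativity).

(* The (k, l) matrix coefficient of s for the action of S_N on K[x_i : i in N],
   as an element of L_CN. *)
Definition Phi N k l s : fsum K (lmon n) :=
  fmap (pC N) (frestr (fun m => acts N m l k) s).

Definition psi N k l g s : K :=
  ev (fun m => if acts N m l k then g (pC N m) else 0) s.

Lemma ev_Phi N k l g s : ev g (Phi N k l s) = psi N k l g s.
Proof. by rewrite ev_map ev_restr. Qed.

Lemma Phi_supp N k l s : in_sub (Lsupp (~: N)) (Phi N k l s).
Proof.
apply/in_subP => g g0; rewrite ev_Phi -[RHS](ev0 s).
by apply: eq_ev => m; rewrite g0 ?if_same // pC_supp.
Qed.

Lemma psi_eq N k l g s t : fequiv s t -> psi N k l g s = psi N k l g t.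
Proof. by move=> /fequivP st; exact: st. Qed.

Lemma Phi_eq N k l s t : fequiv s t -> fequiv (Phi N k l s) (Phi N k l t).
Proof. by move=> st; apply/fequivP => g; rewrite !ev_Phi (psi_eq _ _ _ _ st). Qed.

Lemma psi_ext N k k' l l' g g' s : {in N, k =1 k'} -> {in N, l =1 l'} ->
  g =1 g' -> psi N k l g s = psi N k' l' g' s.
Proof.
by move=> kk ll gg; apply: eq_ev => m; rewrite (acts_ext _ ll kk) gg.
Qed.

Lemma psi_mul N k l g s t : psi N k l g (s ** t) =
  ev (fun m => if leN N (fun i => (m i).1) k then
     psi N (fun i => (m i).2 + (k i - (m i).1))%N l
       (fun z => g (lmul (pC N m) z)) t else 0) s.
Proof.
rewrite /psi ev_mul; apply: eq_ev => m; rewrite -ev_if; apply: eq_ev => m'.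
by rewrite acts_mul pC_mul; case: leN.
Qed.

Lemma psi_mulr1 N k l g m t : psi N k l g (t ** [:: (1, m)]) =
  if leN N (fun i => (m i).2) l then
     psi N k (fun i => (m i).1 + (l i - (m i).2))%N
       (fun z => g (lmul z (pC N m))) t else 0.
Proof.
rewrite /psi ev_mul -ev_if; apply: eq_ev => m'.
rewrite ev_cons ev_nil mul1r addr0 /=.
by rewrite acts_mulr pC_mul; case: leN.
Qed.

Lemma psi_mull1 N k l g m t : psi N k l g ([:: (1, m)] ** t) =
  if leN N (fun i => (m i).1) k then
     psi N (fun i => (m i).2 + (k i - (m i).1))%N l
       (fun z => g (lmul (pC N m) z)) t else 0.
Proof. by rewrite psi_mul ev_cons ev_nil mul1r addr0. Qed.

Definition eps (i : 'I_n) : fsum K (smon n) := [:: (1, sone n); (-1, xy i)].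

Lemma eps_mul i s : fequiv (eps i ** s) (fdiff s ([:: (1, xy i)] ** s)).
Proof.
apply/fequivP => f; rewrite ev_diff !ev_mul !ev_cons !ev_nil /=.
rewrite !mul1r mulN1r !addr0; congr (_ - _); apply: eq_ev => m.
by rewrite smul1.
Qed.

Lemma mul_eps i s : fequiv (s ** eps i) (fdiff s (s ** [:: (1, xy i)])).
Proof.
apply/fequivP => f; rewrite ev_diff !ev_mul -[X in _ - X]mul1r -mulNr.
rewrite -ev_mulf -ev_add; apply: eq_ev => m.
rewrite !ev_cons !ev_nil /= !mul1r !addr0; congr (f _ + _).
apply/ffunP => i'; rewrite !ffunE /bmul.
by case: (m i') => ? ? /=; congr (_, _); lia.
Qed.

(** For i in N, x_i y_i fixes e_k when k_i > 0 and kills it when k_i = 0. For i outside N it becomes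
    1 in L_CN, so the product vanishes; the implication covers both cases. *)
Lemma psi_epsl N k l g i t : psi N k l g (eps i ** t) =
  if (i \in N) ==> (0 < k i)%N then 0 else psi N k l g t.
Proof.
rewrite (psi_eq _ _ _ _ (eps_mul i t)) /psi ev_diff -/(psi N k l g t).
rewrite -/(psi N k l g _) psi_mull1.
have -> : leN N (fun j => (xy i j).1) k = ((i \in N) ==> (0 < k i)%N).
  apply/forallP/idP => [/(_ i)|H j]; first by rewrite ffunE eqxx.
  by rewrite ffunE; case: eqP => [->//|_]; rewrite implybT.
case: ifP => H; last by rewrite subr0.
rewrite (psi_ext (k' := k) (l' := l) (g' := g)) ?subrr //.
  move=> j jN; rewrite ffunE; case: eqP => [ji|_] /=; last lia.
  by rewrite ji in jN *; move: H; rewrite jN /=; lia.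
by move=> z; rewrite pC_xy lmul1.
Qed.

Lemma psi_epsr N k l g i t : psi N k l g (t ** eps i) =
  if (i \in N) ==> (0 < l i)%N then 0 else psi N k l g t.
Proof.
rewrite (psi_eq _ _ _ _ (mul_eps i t)) /psi ev_diff -/(psi N k l g t).
rewrite -/(psi N k l g _) psi_mulr1.
have -> : leN N (fun j => (xy i j).2) l = ((i \in N) ==> (0 < l i)%N).
  apply/forallP/idP => [/(_ i)|H j]; first by rewrite ffunE eqxx.
  by rewrite ffunE; case: eqP => [->//|_]; rewrite implybT.
case: ifP => H; last by rewrite subr0.
rewrite (psi_ext (k' := k) (l' := l) (g' := g)) ?subrr //.
  move=> j jN; rewrite ffunE; case: eqP => [ji|_] /=; last lia.
  by rewrite ji in jN *; move: H; rewrite jN /=; lia.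
by move=> z; rewrite pC_xy lmulC lmul1.
Qed.

(* The idempotent prod_(i in r) (1 - x_i y_i), which projects onto the span of
   the basis vectors of weight 0 in the directions of r. *)
Definition Eidem (r : seq 'I_n) : fsum K (smon n) :=
  foldr (fun i a => eps i ** a) [:: (1, sone n)] r.

Lemma psi_El N k l g r t : {subset r <= N} -> psi N k l g (Eidem r ** t) =
  if all (fun i => k i == 0)%N r then psi N k l g t else 0.
Proof.
elim: r => [_|i r IH rN] /=.
  by apply: psi_eq; apply/fequivP => f; rewrite ev_mul ev_cons ev_nil /= mul1r
    addr0; apply: eq_ev => m; rewrite smul1.
rewrite -(psi_eq _ _ _ _ (fmulA (@smulA n) _ _ _)) psi_epsl rN ?mem_head //=.
rewrite IH; last by move=> j jr; rewrite rN // inE jr orbT.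
by rewrite lt0n; case: (k i == 0)%N.
Qed.

Lemma smulr1 m : smul m (sone n) = m.
Proof.
apply/ffunP => i; rewrite !ffunE /bmul.
by case: (m i) => ? ? /=; congr (_, _); lia.
Qed.

Lemma psi_Er N k l g r t : {subset r <= N} -> psi N k l g (t ** Eidem r) =
  if all (fun i => l i == 0)%N r then psi N k l g t else 0.
Proof.
elim: r t => [|i r IH] t rN /=.
  by apply: psi_eq; apply/fequivP => f; rewrite ev_mul; apply: eq_ev => m;
    rewrite ev_cons ev_nil /= mul1r addr0 smulr1.
rewrite (psi_eq _ _ _ _ (fmulA (@smulA n) _ _ _)).
rewrite IH; last by move=> j jr; rewrite rN // inE jr orbT.
by rewrite psi_epsr rN ?mem_head //= lt0n; case: (l i == 0)%N; case: all.
Qed.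

(** The L_CN-coefficient of s at the N-part of m, for s read in S_N (x) L_CN. *)
Definition slice N m s : fsum K (lmon n) :=
  fmap (pC N) (frestr (fun x => restr N x == restr N m) s).

(* Phi_(k,l) is the sum of the slices at x^(k-j) y^(l-j), so the slices are
   recovered from the matrix coefficients by a triangular induction. *)
Lemma slices_of_Phi N (q : fsum K (lmon n) -> Prop) s :
  is_ideal (@lmul n) (Lsupp (~: N)) q ->
  (forall k l, q (Phi N k l s)) -> forall m, q (slice N m s).
Proof.
move=> idq H m; have [w] := ubnP (\sum_(i in N) (m i).2).
elim: w m => // w IH m; rewrite ltnS => mw.
(* With these k and l the N-part of m is the case j = 0. Every other monomial sending e_l to e_k has
   j > 0 in some direction of N, hence a smaller total y-degree there, and the induction hypothesis
   applies. *)
pose k i := (m i).1; pose l i := (m i).2.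
pose C v := acts N v l k && (v != restr N m).
have Iw : q (fmap (pC N) (frestr (C \o restr N) s)).
  apply: fibre_sum => [t u| |t u|m' /andP[]].
  - exact: ideal_eq idq _ _.
  - exact: ideal_nil idq.
  - exact: ideal_cat idq _ _.
  rewrite acts_restr => /forallP A ne; apply: IH; apply: leq_trans mw.
  have [i iN ni] : exists2 i, i \in N & m' i != m i.
    apply/exists_inP; apply: contraR ne; rewrite negb_exists_in => /forall_inP ne.
    apply/eqP/ffunP => i; rewrite !ffunE; case: ifP => // iN.
    by have := ne i iN; rewrite negbK => /eqP.
  rewrite (bigD1 i) // [X in (_ < X)%N](bigD1 i) //= -addSn leq_add //.
    move: (A i) ni; rewrite iN /= /actc /k /l.
    case: (m' i) (m i) => a b [c d] /= /andP[bd /eqP E] ne'.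
    rewrite ltn_neqAle bd andbT; apply: contraNneq ne' => bd'.
    by rewrite -E bd' subnn addn0.
  apply: leq_sum => j /andP[jN _]; move: (A j); rewrite jN /= /actc /l.
  by case/andP.
apply: (ideal_eq idq _ (ideal_cat idq (H k l) (ideal_scale idq (-1) Iw))).
apply/fequivP => f; rewrite ev_cat ev_scale !ev_map !ev_restr /ev.
rewrite mulr_sumr -big_split; apply: eq_bigr => p _ /=.
rewrite /C acts_restr; have [rm|_] := eqVneq (restr N p.2) (restr N m).
  rewrite andbF mulr0 mulr0 addr0 -acts_restr rm acts_restr.
  suff -> : acts N m l k by [].
  apply/forallP => i; apply/implyP => _.
  by rewrite /actc leqnn subnn addn0 eqxx.
by rewrite andbT mulr0; case: acts; rewrite ?mulN1r ?subrr ?mulr0 ?addr0.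
Qed.

(** Allows the triangular induction to be run with q = 0, which yields faithfulness. *)
Lemma zero_ideal (M : eqType) (mmul : M -> M -> M) (P : pred M) :
  is_ideal mmul P (fun s : fsum K M => fequiv s [::]).
Proof.
have z (u : fsum K M) : fequiv u [::] <-> forall f, ev f u = 0.
  by rewrite fequivP; split=> H f; rewrite H ev_nil.
split=> [s s0|]; first by apply/in_subP => f _; exact: (proj1 (z s) s0).
split=> [s t s0 st m|]; first by rewrite -st s0.
split=> //; split=> [s t /z s0 /z t0|].
  by apply/z => f; rewrite ev_cat s0 t0 addr0.
split=> [c s /z s0|a s _ /z s0]; first by apply/z => f; rewrite ev_scale s0 mulr0.
split; apply/z => f; rewrite ev_mul ?s0 // -[RHS](ev0 a).
by apply: eq_ev => m; rewrite s0.
Qed.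

(** For N the full set a slice is a single coefficient. Identities involving idempotents thus reduce
    to comparing boolean conditions direction by direction. *)
Lemma S_faithful s t :
  (forall k l g, psi setT k l g s = psi setT k l g t) -> fequiv s t.
Proof.
move=> H; suff E : forall m, coef (fdiff s t) m = 0.
  move=> m; apply/eqP; rewrite -subr_eq0; apply/eqP.
  by rewrite !coefE -ev_diff -coefE.
move=> m; rewrite coefE.
have /fequivP/(_ (fun=> 1)) : fequiv (slice setT m (fdiff s t)) [::].
  apply: (slices_of_Phi (q := fun u => fequiv u [::])) => [|k l].
    exact: zero_ideal.
  by apply/fequivP => g; rewrite ev_Phi ev_nil /psi ev_diff; apply/eqP;
    rewrite subr_eq0; apply/eqP; exact: H.
rewrite ev_nil ev_map ev_restr => E; rewrite -[RHS]E; apply: eq_ev => x /=.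
have rT y : restr [set: 'I_n] y = y by apply/ffunP => i; rewrite ffunE inE.
by rewrite !rT.
Qed.

End Coefficients.

(** * The ideals S_N (x) pi^-1(q), their primality and their invariants *)

Section PrimeSpectrum.
Variables (K : fieldType) (n : nat).
Implicit Types (N : {set 'I_n}) (m : smon n) (k l : 'I_n -> nat).
Implicit Types (s a b : fsum K (smon n)) (q : fsum K (lmon n) -> Prop).
Local Notation "s ** t" := (fmul (@smul n) s t) (at level 40, left associativity).
Local Notation Lideal N q := (is_ideal (@lmul n) (Lsupp (~: N)) q).
Local Notation Sideal p := (is_ideal (@smul n) predT p).

Lemma in_subT s : in_sub predT s. Proof. by []. Qed.
Arguments in_subT : clear implicits.

(** Monomials of S_CN act as the identity in the directions of N, and monomials of S_N have image 1
    in L_CN. *)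
Lemma Phi_tensor N k l a b : in_sub (Ssupp N) a -> in_sub (Ssupp (~: N)) b ->
  fequiv (Phi N k l (a ** b))
    (fscale (ev (fun m => if acts N m l k then 1 else 0) a) (piS b)).
Proof.
move=> Na Nb; apply/fequivP => g; rewrite ev_Phi ev_scale /psi ev_mul.
rewrite mulrC -ev_mulf; apply: (ev_in_sub Na) => m /forallP Nm.
transitivity (ev (fun m' => if acts N m l k then g (pimon m') else 0) b).
  apply: (ev_in_sub Nb) => m' /forallP Nm'.
  have -> : acts N (smul m m') l k = acts N m l k.
    apply: eq_forallb => i; case iN: (i \in N) => //=.
    move: (Nm' i); rewrite inE iN ffunE => /eqP ->.
    by rewrite /actc /bmul /=; case: (m i) => ? ? /=; lia.
  congr (if _ then g _ else _); apply/ffunP => i; rewrite !ffunE.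
  case: ifP => iN; first by move: (Nm' i); rewrite inE iN => /eqP ->.
  by move: (Nm i); rewrite iN => /eqP ->; rewrite /bmul /=; case: (m' i) => ? ? /=; lia.
rewrite ev_if; case: acts; rewrite ?mulr0 // mulr1.
by rewrite -[RHS]/(ev g (fmap _ b)) ev_map.
Qed.

(** Writing s as the sum of v b_v over the monomials v of S_N, with b_v in S_CN, the image of b_v
    under pi is the slice of s at v. So once all slices lie in q, this sum is itself the required
    tensor decomposition. *)
Lemma SpartP N q s : Lideal N q ->
  Spart N q s <-> forall k l, q (Phi N k l s).
Proof.
move=> idq; split=> [[ps [Hps sE]] k l|].
  apply: (ideal_eq idq (Phi_eq _ _ _ (fequiv_sym sE))) => {sE}.
  elim: ps Hps => [_|[a b] ps IH Hps] /=; first exact: ideal_nil idq.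
  have [Na [Nb qb]] := Hps _ (mem_head _ _).
  have {}IH := IH (fun x xps => Hps x (mem_behead (s := _ :: ps) xps)).
  rewrite /Phi /frestr filter_cat /fmap map_cat.
  apply: (ideal_cat idq _ IH).
  exact: (ideal_eq idq (fequiv_sym (Phi_tensor _ _ Na Nb)) (ideal_scale idq _ qb)).
move/(slices_of_Phi idq) => H.
have Seq t u : fequiv t u -> Spart N q t -> Spart N q u.
  by move=> tu [ps [Hps E]]; exists ps; split=> // m; rewrite -tu E.
have: Spart N q (fmap id (frestr (predT \o restr N) s)).
  apply: fibre_sum => // [|t u [ps [Hps E]] [ps' [Hps' E']]|m _].
  - by exists [::].
  - exists (ps ++ ps'); split=> [x|]; first by rewrite mem_cat => /orP[/Hps|/Hps'].
    move/fequivP: E => E; move/fequivP: E' => E'.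
    by apply/fequivP => f; rewrite map_cat flatten_cat !ev_cat E E'.
  pose b := fmap (restr (~: N)) (frestr (fun x => restr N x == restr N m) s).
  exists [:: ([:: (1, restr N m)], b)]; split=> [x|].
    rewrite inE => /eqP -> /=; split; last split.
    - apply: in_sub_all => y; rewrite inE => /eqP -> /=.
      by apply/forallP => i; rewrite ffunE; case: (i \in N).
    - apply: in_sub_all => y /mapP[z _ ->] /=.
      by apply/forallP => i; rewrite ffunE; case: (i \in ~: N).
    apply: (ideal_eq idq _ (H m)); apply/fequivP => f.
    rewrite -[piS b]/(fmap _ b) !ev_map; apply: eq_ev => y /=; congr f.
    by apply/ffunP => i; rewrite !ffunE inE; case: (i \in N); rewrite ?subrr.
  apply/fequivP => f; rewrite /= cats0 ev_mul ev_cons ev_nil mul1r addr0.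
  rewrite !ev_map !ev_restr; apply: eq_ev => y /=; case: eqP => // <-.
  congr f; apply/ffunP => i; rewrite !ffunE inE /bmul; case: (i \in N) => /=.
    by case: (y i) => ? ? /=; congr (_, _); lia.
  by case: (y i) => ? ? /=; congr (_, _); lia.
apply: Seq; apply/fequivP => f; rewrite ev_map ev_restr; exact: eq_ev.
Qed.

(** For a monomial a, row k of the matrix of a s is zero or a row of the matrix of s times a
    monomial of L_CN. *)
Lemma Phi_mull N k l q a s : Lideal N q -> (forall k l, q (Phi N k l s)) ->
  q (Phi N k l (a ** s)).
Proof.
move=> idq H; elim: a => [|p a IH]; first exact: ideal_nil idq.
pose k' i := ((p.2 i).2 + (k i - (p.2 i).1))%N.
pose t := if leN N (fun i => (p.2 i).1) k
  then fmul (@lmul n) [:: (1, pC N p.2)] (Phi N k' l s) else [::].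
have qt : q t.
  rewrite /t; case: ifP => _; last exact: ideal_nil idq.
  apply: (ideal_mull idq) (H _ _); apply: in_sub_all => x.
  by rewrite inE => /eqP ->; exact: pC_supp.
apply: (ideal_eq idq _ (ideal_cat idq (ideal_scale idq p.1 qt) IH)).
apply/fequivP => g; rewrite ev_cat ev_scale !ev_Phi !psi_mul ev_cons.
congr (_ * _ + _); rewrite /t; case: ifP => _; last by rewrite ev_nil.
by rewrite ev_mul ev_cons ev_nil mul1r addr0 ev_Phi.
Qed.

Lemma Phi_mulr N k l q a s : Lideal N q -> (forall k l, q (Phi N k l s)) ->
  q (Phi N k l (s ** a)).
Proof.
move=> idq H; elim: a => [|p a IH].
  apply: (ideal_eq idq _ (ideal_nil idq)); apply/fequivP => g.
  rewrite ev_Phi /psi ev_mul ev_nil -[LHS](ev0 s).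
  by apply: eq_ev => m; rewrite ev_nil.
pose l' i := ((p.2 i).1 + (l i - (p.2 i).2))%N.
pose t := if leN N (fun i => (p.2 i).2) l
  then fmul (@lmul n) (Phi N k l' s) [:: (1, pC N p.2)] else [::].
have qt : q t.
  rewrite /t; case: ifP => _; last exact: ideal_nil idq.
  apply: (ideal_mulr idq) (H _ _); apply: in_sub_all => x.
  by rewrite inE => /eqP ->; exact: pC_supp.
apply: (ideal_eq idq _ (ideal_cat idq (ideal_scale idq p.1 qt) IH)).
apply/fequivP => g; rewrite ev_cat ev_scale !ev_Phi.
have E : fequiv (s ** (p :: a)) (fscale p.1 (s ** [:: (1, p.2)]) ++ s ** a).
  apply/fequivP => f; rewrite ev_cat ev_scale !ev_mul -ev_mulf -ev_add.
  by apply: eq_ev => m; rewrite !ev_cons ev_nil mul1r addr0.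
rewrite (psi_eq _ _ _ _ E) {2}/psi ev_cat ev_scale.
rewrite -!/(psi _ _ _ _ _); congr (_ * _ + _).
rewrite psi_mulr1 /t; case: ifP => _; last by rewrite ev_nil.
rewrite ev_mul -ev_Phi; apply: eq_ev => m.
by rewrite ev_cons ev_nil mul1r addr0.
Qed.

Lemma Spart_ideal N q : Lideal N q -> Sideal (Spart N q).
Proof.
move=> idq; have SP s := SpartP s idq.
split=> //; split=> [s t /SP H st|].
  by apply/SP => k l; exact: (ideal_eq idq (Phi_eq _ _ _ st) (H k l)).
split; first by apply/SP => k l; exact: ideal_nil idq.
split=> [s t /SP Hs /SP Ht|].
  apply/SP => k l; rewrite /Phi /frestr filter_cat /fmap map_cat.
  exact: (ideal_cat idq (Hs k l) (Ht k l)).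
split=> [c s /SP H|a s _ /SP H].
  apply/SP => k l; apply: (ideal_eq idq _ (ideal_scale idq c (H k l))).
  by apply/fequivP => g; rewrite ev_scale !ev_Phi /psi ev_scale.
by split; apply/SP => k l; [exact: Phi_mull | exact: Phi_mulr].
Qed.

Definition xpow N k : smon n := [ffun i => if i \in N then (k i, 0%N) else (0%N, 0%N)].
Definition ypow N k : smon n := [ffun i => if i \in N then (0%N, k i) else (0%N, 0%N)].

Lemma all_enum_set N (A : pred 'I_n) :
  all A (enum N) = [forall i, (i \in N) ==> A i].
Proof.
apply/allP/forall_inP => H i iN; apply: H; first by rewrite mem_enum.
by rewrite mem_enum in iN.
Qed.

Local Notation E N := (Eidem K (enum N)).

(* x^l E y^k' plays the role of the matrix unit E_(l, k'). *)
Lemma Phi_sandwich N k l k' l' a b :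
  fequiv (Phi N k l' (a ** ([:: (1, xpow N l)] ** (E N ** ([:: (1, ypow N k')] ** b)))))
    (fmul (@lmul n) (Phi N k l a) (Phi N k' l' b)).
Proof.
apply/fequivP => g; rewrite ev_Phi psi_mul ev_mul ev_map ev_restr.
apply: eq_ev => m; rewrite psi_mull1 psi_El; last by move=> i; rewrite mem_enum.
rewrite psi_mull1 all_enum_set.
(* Starting from row k, the monomial m = x^a y^b leads to the index b + (k - a). Passing x^l
   requires l to be at most this index, and E requires the truncated difference to be 0; together
   they say that the index is l. *)
have -> : acts N m l k = leN N (fun i => (m i).1) k &&
    (leN N (fun i => (xpow N l i).1) (fun i => (m i).2 + (k i - (m i).1))%N &&
    [forall i, (i \in N) ==> ((xpow N l i).2 + ((m i).2 + (k i - (m i).1) -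
      (xpow N l i).1) == 0)%N]).
  rewrite -!forall_andb; apply: eq_forallb => i; rewrite ffunE.
  by case: (i \in N) => //=; rewrite /actc; case: (m i) => ? ? /=; lia.
case: leN => //=; case: leN => //=; case: forallP => //= H.
have -> : leN N (fun i => (ypow N k' i).1) (fun i => (xpow N l i).2 +
    ((m i).2 + (k i - (m i).1) - (xpow N l i).1))%N.
  by apply/forallP => i; rewrite ffunE; case: (i \in N).
rewrite ev_Phi; apply: psi_ext => // [i iN|z].
  by move: (H i); rewrite iN => /eqP ->; rewrite ffunE iN /= addn0.
congr g; apply/ffunP => i; rewrite !ffunE.
by case: (i \in N); rewrite ?add0r ?subrr // !add0r.
Qed.

Lemma prime_unit N q : Lprime (~: N) q -> ~ q [:: (1, lone n)].
Proof.
move=> [idq [[s [Ns qs]] _]] q1; apply: qs.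
apply: (ideal_eq idq _ (ideal_mulr idq Ns q1)).
apply/fequivP => f; rewrite ev_mul ev_cons ev_nil mul1r addr0.
by apply: eq_ev => z; rewrite lmul1.
Qed.

(** L_CN is commutative, so f z g = z f g lies in q for every monomial z and the elementwise
    criterion applies. *)
Lemma Lprime_mul N q f g : Lprime (~: N) q ->
  in_sub (Lsupp (~: N)) f -> in_sub (Lsupp (~: N)) g ->
  q (fmul (@lmul n) f g) -> q f \/ q g.
Proof.
move=> prq Nf Ng qfg; have idq := proj1 prq.
apply: (prime_elements (@Lsupp_mul n _) (@lmulA n) (@lmul1 n) (@Lsupp1 n _) prq) => //.
move=> z Nz; have Nz1 : in_sub (Lsupp (~: N)) [:: (1 : K, z)].
  by apply: in_sub_all => x; rewrite inE => /eqP ->.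
apply: (ideal_eq idq _ (ideal_mull idq Nz1 qfg)); apply/fequivP => h.
rewrite !ev_mul ev_cons ev_nil mul1r addr0; rewrite ev_mul.
apply: eq_ev => x; rewrite ev_cons ev_nil mul1r addr0; apply: eq_ev => y.
by rewrite lmulA [lmul z x]lmulC.
Qed.

Lemma Spart_prime N q : Lprime (~: N) q -> Sprime (Spart N q).
Proof.
move=> prq; have idq := proj1 prq; have SP s := SpartP s idq.
split; first exact: Spart_ideal.
split.
  exists [:: (1, sone n)]; split=> // /SP/(_ (fun=> 0%N) (fun=> 0%N)) H.
  apply: (prime_unit prq); apply: (ideal_eq idq _ H); apply/fequivP => g.
  rewrite ev_Phi /psi !ev_cons !ev_nil /= pC1.
  suff -> : acts N (sone n) (fun=> 0%N) (fun=> 0%N) by [].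
  by apply/forallP => i; rewrite ffunE implybT.
move=> J1 J2 iJ1 iJ2 J12; apply: NNPP => /not_or_and[Ha Hb].
have [a Ha'] := not_all_ex_not _ _ Ha; have [J1a na] := imply_to_and _ _ Ha'.
have [b Hb'] := not_all_ex_not _ _ Hb; have [J2b nb] := imply_to_and _ _ Hb'.
have [k [l nq]] : exists k l, ~ q (Phi N k l a).
  apply: NNPP => H; apply: na; apply/SP => k l; apply: NNPP => nq.
  by apply: H; exists k, l.
have [k' [l' nq']] : exists k l, ~ q (Phi N k l b).
  apply: NNPP => H; apply: nb; apply/SP => k' l'; apply: NNPP => nq'.
  by apply: H; exists k', l'.
have J2w : J2 ([:: (1, xpow N l)] ** (E N ** ([:: (1, ypow N k')] ** b))).
  by do 3!apply: (ideal_mull iJ2) => //.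
have /SP/(_ k l') H := J12 _ _ J1a J2w.
have {}H := ideal_eq idq (Phi_sandwich _ _ _ _ _ _ _) H.
by case: (Lprime_mul prq (@Phi_supp _ _ _ _ _ _) (@Phi_supp _ _ _ _ _ _) H).
Qed.

(** This recovers N from the ideal: for i in N the (0, 0) coefficient of 1 - x_i y_i is 1, and for i
    outside N all coefficients vanish. *)
Lemma Spart_eps N q i : Lprime (~: N) q -> Spart N q (eps K i) <-> i \notin N.
Proof.
move=> prq; have idq := proj1 prq.
have E1 : fequiv (eps K i) (eps K i ** [:: (1, sone n)]).
  apply/fequivP => f; rewrite ev_mul; apply: eq_ev => m.
  by rewrite ev_cons ev_nil /= mul1r addr0 smulr1.
rewrite SpartP //; split=> [/(_ (fun=> 0%N) (fun=> 0%N)) H|iN k l].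
  apply/negP => iN; apply: (prime_unit prq); apply: (ideal_eq idq _ H).
  apply/fequivP => g; rewrite ev_Phi (psi_eq _ _ _ _ E1) psi_epsl iN /=.
  rewrite /psi !ev_cons !ev_nil /= pC1.
  suff -> : acts N (sone n) (fun=> 0%N) (fun=> 0%N) by [].
  by apply/forallP => j; rewrite ffunE implybT.
apply: (ideal_eq idq _ (ideal_nil idq)); apply/fequivP => g.
by rewrite ev_Phi (psi_eq _ _ _ _ E1) psi_epsl (negPf iN) ev_nil.
Qed.

(** A section of pi on monomials by pure powers of x_i or y_i. It is not multiplicative, since x_i
    y_i is not 1 in S_n. [Negz b] stands for -(b + 1), whence the exponent [b.+1]. *)
Definition lift N (z : lmon n) : smon n :=
  [ffun i => if i \in N then (0%N, 0%N) else
     match z i with Posz a => (a, 0%N) | Negz b => (0%N, b.+1) end].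

Lemma lift_diff N z i : i \notin N ->
  (lift N z i).1%:Z - (lift N z i).2%:Z = z i.
Proof. by move=> /negPf iN; rewrite ffunE iN; case: (z i) => c /=; rewrite ?NegzE; lia. Qed.

(** The lift of t involves no variable of N, so its matrix coefficients are t on the diagonal and 0
    elsewhere. This recovers q from the ideal. *)
Lemma Spart_lift N q (t : fsum K (lmon n)) : Lprime (~: N) q -> in_sub (Lsupp (~: N)) t ->
  Spart N q (fmap (lift N) t) <-> q t.
Proof.
move=> prq Nt; have idq := proj1 prq; rewrite SpartP //.
have PhiE k l : fequiv (Phi N k l (fmap (lift N) t))
    (if [forall i, (i \in N) ==> (l i == k i)] then t else [::]).
  apply/fequivP => g; rewrite ev_Phi /psi ev_map.
  have -> : (if [forall i, (i \in N) ==> (l i == k i)] then t else [::]) =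
    frestr (fun=> [forall i, (i \in N) ==> (l i == k i)]) t.
    by case: ifP; rewrite /frestr ?filter_predT ?filter_pred0.
  rewrite ev_restr; apply: (ev_in_sub Nt) => z /forallP Nz /=.
  have -> : acts N (lift N z) l k = [forall i, (i \in N) ==> (l i == k i)].
    apply: eq_forallb => i; rewrite ffunE; case: (i \in N) => //=.
    by rewrite /actc /= subn0.
  congr (if _ then g _ else _); apply/ffunP => i; rewrite !ffunE.
  case iN: (i \in N); first by move: (Nz i); rewrite inE iN => /eqP ->.
  by have := @lift_diff N z i; rewrite ffunE iN; apply.
split=> [/(_ (fun=> 0%N) (fun=> 0%N)) H|qt k l].
  apply: (ideal_eq idq _ H) => x; rewrite PhiE.
  suff -> : [forall i, (i \in N) ==> (0 == 0)%N] by [].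
  by apply/forallP => i; rewrite eqxx implybT.
apply: (ideal_eq idq (fequiv_sym (PhiE k l))).
by case: ifP => // _; exact: ideal_nil idq.
Qed.

(* Congruence modulo the ideal of S_n generated by a_CN. *)
Definition cong N (m m' : smon n) : Prop := forall i,
  if i \in N then m i = m' i
  else (m i).1%:Z - (m i).2%:Z = (m' i).1%:Z - (m' i).2%:Z :> int.

(** * Rewriting modulo an ideal that contains 1 - x_i y_i for i outside N *)

Section Congruence.
Variables (p : fsum K (smon n) -> Prop) (N : {set 'I_n}).
Hypothesis idp : Sideal p.
Hypothesis peps : forall i, i \notin N -> p (eps K i).

(** The difference m' - m is u (1 - x_i y_i) v, where u and v split m in direction i into x^(a-1)
    and y^(b-1), and u carries the other directions. *)
Lemma cong_step m i : i \notin N -> (0 < (m i).1)%N -> (0 < (m i).2)%N ->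
  exists m', [/\ cong N m m', p (fdiff [:: (1, m')] [:: (1, m)]) &
    (\sum_j (m' j).1 < \sum_j (m j).1)%N].
Proof.
move=> iN m1 m2.
pose u : smon n := [ffun j => if j == i then ((m i).1.-1, 0%N) else m j].
pose v : smon n := [ffun j => if j == i then (0%N, (m i).2.-1) else (0%N, 0%N)].
have uv : smul u v = [ffun j => if j == i then ((m i).1.-1, (m i).2.-1) else m j].
  apply/ffunP => j; rewrite !ffunE /bmul; case: eqP => _ /=; last first.
    by case: (m j) => ? ? /=; congr (_, _); lia.
  by congr (_, _); lia.
exists (smul u v); split.
- move=> j; rewrite uv ffunE; case: eqP => [->|_]; last by case: ifP.
  by rewrite (negPf iN) /=; case: (m i) m1 m2 => /= ? ?; lia.
- apply: (ideal_eq idp _ (ideal_mulr idp (a := [:: (1, v)]) _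
    (ideal_mull idp (a := [:: (1, u)]) _ (peps iN)))) => //.
  apply/fequivP => f; rewrite ev_diff !ev_mul !ev_cons !ev_nil /=.
  rewrite !mul1r !addr0 mulN1r smulr1; congr (_ - f _).
  apply/ffunP => j; rewrite !ffunE /bmul; case: eqP => [->|_] /=; last first.
    by case: (m j) => ? ? /=; congr (_, _); lia.
  by case: (m i) m1 m2 => /= ? ?; move=> ? ?; congr (_, _); lia.
rewrite uv (bigD1 i) // [X in (_ < X)%N](bigD1 i) //= -addSn leq_add //.
  by rewrite ffunE eqxx /= prednK.
by apply: leq_sum => j /negPf ji; rewrite ffunE ji.
Qed.

Lemma diff_trans s t u : p (fdiff s t) -> p (fdiff t u) -> p (fdiff s u).
Proof.
move=> st tu; apply: (ideal_eq idp _ (ideal_cat idp st tu)).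
apply/fequivP => f; rewrite ev_cat !ev_diff; ring.
Qed.

Lemma diff_sym s t : p (fdiff s t) -> p (fdiff t s).
Proof.
move=> st; apply: (ideal_eq idp _ (ideal_scale idp (-1) st)).
apply/fequivP => f; rewrite ev_scale !ev_diff; ring.
Qed.

Lemma cong_mem m m' : cong N m m' -> p (fdiff [:: (1, m)] [:: (1, m')]).
Proof.
have [w] := ubnP (\sum_j (m j).1 + \sum_j (m' j).1).
elim: w m m' => // w IH m m'; rewrite ltnS => mw C.
have [->|ne] := eqVneq m m'.
  apply: (ideal_eq idp _ (ideal_nil idp)); apply/fequivP => f.
  by rewrite ev_diff ev_nil subrr.
have [i ni] : exists i, m i != m' i.
  apply/existsP; apply: contraR ne; rewrite negb_exists => /forallP ne.
  by apply/eqP/ffunP => i; have := ne i; rewrite negbK => /eqP.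
move: (C i); case: ifP => [iN mi|/negbT iN mi]; first by rewrite mi eqxx in ni.
(* The differences of exponents agree at i, so the monomial with the larger x-exponent has both
   exponents positive there and can be lowered. *)
have [lt|lt|eq] := ltngtP (m i).1 (m' i).1.
- have [||m'' [C' pd lt']] := @cong_step m' i iN; [lia|lia|].
  apply: diff_trans (pd); apply: IH => [|j].
    by apply: leq_trans mw; rewrite ltn_add2l.
  by move: (C j) (C' j); case: ifP => _ -> ->.
- have [||m'' [C' pd lt']] := @cong_step m i iN; [lia|lia|].
  apply: diff_trans (diff_sym pd) _; apply: IH => [|j].
    by apply: leq_trans mw; rewrite ltn_add2r.
  by move: (C j) (C' j); case: ifP => _ -> ->.
case/eqP: ni; move: mi eq; case: (m i) (m' i) => ? ? [? ?] /= mi eq.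
by congr (_, _); lia.
Qed.

Lemma fmap_cong (X : eqType) (h h' : X -> smon n) (s : fsum K X) :
  {in s, forall x, cong N (h x.2) (h' x.2)} -> p (fdiff (fmap h s) (fmap h' s)).
Proof.
elim: s => [_|x s IH H]; first exact: ideal_nil idp.
have {}IH := IH (fun y ys => H y (mem_behead (s := x :: s) ys)).
have Hx := ideal_scale idp x.1 (cong_mem (H x (mem_head _ _))).
apply: (ideal_eq idp _ (ideal_cat idp Hx IH)); apply/fequivP => f.
rewrite ev_cat ev_scale !ev_diff !ev_map !ev_cons !ev_nil /=; ring.
Qed.

End Congruence.

(** * A given prime: the idempotent E and the contraction to L_CN *)

Section PrimeIdeal.
Variable p : fsum K (smon n) -> Prop.
Hypothesis prp : Sprime p.
Let idp : Sideal p := proj1 prp.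

Lemma Sprime_elements a b :
  (forall m, p (a ** [:: (1, m)] ** b)) -> p a \/ p b.
Proof.
move=> H.
by apply: (prime_elements _ (@smulA n) (@smul1 n) _ prp) => // m _; exact: H.
Qed.

Lemma Sprime_unit : ~ p [:: (1, sone n)].
Proof.
move=> p1; have [_ [[s [_ ns]] _]] := prp; apply: ns.
apply: (ideal_eq idp _ (ideal_mull idp (in_subT s) p1)); apply/fequivP => f.
by rewrite ev_mul; apply: eq_ev => m; rewrite ev_cons ev_nil mul1r addr0 smulr1.
Qed.

Lemma pCT m : pC setT m = lone n.
Proof. by apply/ffunP => i; rewrite !ffunE inE. Qed.

Lemma psiT_mono k l g m :
  psi setT k l g [:: (1 : K, m)] = if acts setT m l k then g (lone n) else 0.
Proof. by rewrite /psi ev_cons ev_nil mul1r addr0 pCT. Qed.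

Lemma psiT_Eidem r k l g : psi setT k l g (Eidem K r) =
  if all (fun i => k i == 0%N) r && [forall i, l i == k i] then g (lone n) else 0.
Proof.
have E1 : fequiv (Eidem K r) (Eidem K r ** [:: (1, sone n)]).
  apply/fequivP => f; rewrite ev_mul; apply: eq_ev => m.
  by rewrite ev_cons ev_nil /= mul1r addr0 smulr1.
rewrite (psi_eq _ _ _ _ E1) psi_El; last by move=> i; rewrite inE.
rewrite psiT_mono; case: all => //=; congr (if _ then _ else _).
by apply: eq_forallb => i; rewrite inE ffunE /actc /= subn0.
Qed.

(* Since y e = 0 = e x for e = 1 - x y, only pure powers of y_i survive
   between eps i and the idempotent, and these commute past it. *)
Lemma eps_mono_Eidem i r m : i \notin r ->
  p (eps K i ** Eidem K r) -> p (eps K i ** [:: (1, m)] ** Eidem K r).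
Proof.
move=> ir pE.
pose u : smon n := [ffun j => if j == i then (0%N, 0%N) else m j].
pose v : smon n := [ffun j => if j == i then (0%N, (m i).2) else (0%N, 0%N)].
(* If m has no x_i, this is the product to be placed in p: u commutes with [eps K i], and the power
   v of y_i commutes with [Eidem K r] because i is not in r. *)
pose t := [:: (1, u)] ** (eps K i ** Eidem K r) ** [:: (1, v)].
have pt : p t by apply: (ideal_mulr idp) => //; apply: (ideal_mull idp).
have [m0|m1] := posnP (m i).1; last first.
  apply: (ideal_eq idp _ (ideal_nil idp)); apply: S_faithful => k l g.
  rewrite psi_Er; last by move=> j; rewrite inE.
  rewrite psi_epsl inE /= psiT_mono {1}/psi ev_nil.
  case: posnP => [ki|_]; last by rewrite if_same.
  suff -> : acts setT m l k = false by rewrite if_same.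
  apply/negP => /forallP/(_ i); rewrite inE /= /actc ki.
  by case: (m i) m1 => /= ? ?; lia.
apply: (ideal_eq idp _ pt); apply: S_faithful => k l g.
rewrite psi_Er; last by move=> j; rewrite inE.
rewrite psi_epsl inE /= psiT_mono psi_mulr1 psi_mull1 psi_epsl inE /=.
rewrite psiT_Eidem !pCT !lmul1.
have allE (A : pred 'I_n) (r' : seq 'I_n) : all A r' = [forall j, (j \in r') ==> A j].
  by apply/allP/forall_inP.
have oneE (A : pred 'I_n) : A i = [forall j, (j == i) ==> A j].
  apply/idP/forall_inP => [Ai j /eqP -> //|]; exact.
rewrite !lt0n !if_neg !allE.
rewrite (oneE (fun j => k j == 0)%N).
rewrite (oneE (fun j => (u j).2 + (k j - (u j).1) == 0)%N).
have if_and (b c : bool) (x : K) :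
  (if b then (if c then x else 0) else 0) = if b && c then x else 0 by case: b.
rewrite !if_and -!forall_andb; congr (if _ then _ else _).
apply: eq_forallb => j; rewrite !ffunE !inE /actc /=.
have [->|_] := eqVneq j i.
  by rewrite (negPf ir) /=; case: (m i) m0 => /= ? ?; lia.
by case: (m j) => /= ? ?; case: (j \in r) => /=; lia.
Qed.

(** If (1 - x_i y_i) E_r lay in p, so would (1 - x_i y_i) S_n E_r, and primality would put one of
    the two factors in p. *)
Lemma Eidem_notin r : uniq r -> {in r, forall i, ~ p (eps K i)} -> ~ p (Eidem K r).
Proof.
elim: r => [_ _|i r IH /=/andP[ir ur] H pE]; first exact: Sprime_unit.
have [pe|pr] := Sprime_elements (fun m => eps_mono_Eidem m ir pE).
  exact: H (mem_head _ _) pe.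
by apply: IH pr => // j jr; apply: H; rewrite inE jr orbT.
Qed.

Variable N : {set 'I_n}.
Hypothesis NP : forall i, i \in N <-> ~ p (eps K i).

Let peps i : i \notin N -> p (eps K i).
Proof. by move=> iN; apply: NNPP => /NP; apply/negP. Qed.

Let p_cong := fmap_cong idp peps.

(** The preimage of p under the algebra map from L_CN to S_n / p that [lift] induces. *)
Definition contraction (t : fsum K (lmon n)) : Prop :=
  in_sub (Lsupp (~: N)) t /\ p (fmap (lift N) t).

Lemma lift_mono_comm m z : cong N (smul m (lift N z)) (smul (lift N z) m).
Proof.
move=> i; rewrite !ffunE; case: (i \in N).
  by rewrite /bmul; case: (m i) => ? ? /=; congr (_, _); lia.
by rewrite /bmul; case: (m i) => ? ?; case: (z i) => ? /=; lia.
Qed.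

(** Lifts are central modulo p, which supplies the hypothesis of [Sprime_elements] from a single
    product. *)
Lemma ideal_comm_lift a (t : fsum K (lmon n)) m : p (a ** fmap (lift N) t) ->
  p (a ** [:: (1, m)] ** fmap (lift N) t).
Proof.
move=> pa.
have := @p_cong _ (fun z => smul m (lift N z)) (fun z => smul (lift N z) m) t
  (fun z _ => lift_mono_comm m z.2).
move=> /(ideal_mull idp (in_subT a)) H.
have H2 := ideal_mulr idp (in_subT [:: (1 : K, m)]) pa.
apply: (ideal_eq idp _ (ideal_cat idp H H2)); apply/fequivP => f.
rewrite ev_cat !ev_mul -ev_add; apply: eq_ev => x.
rewrite ev_diff !ev_map ev_cons ev_nil mul1r addr0 ev_map addrC.
rewrite [X in X + _](_ : _ = ev (fun z => f (smul x (smul (lift N z) m))) t).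
  by rewrite addrC subrK; apply: eq_ev => z /=; rewrite smulA.
by apply: eq_ev => z /=; rewrite ev_cons ev_nil mul1r addr0 smulA.
Qed.

(** In each direction of N, [u m] is some x^c y^d, and e x = 0 = y e for e = 1 - x y. So E kills it
    from one side unless it is 1 in all these directions, which happens exactly when m sends e_l to
    e_k; it then commutes with E. *)
Lemma Eidem_corner k l s : let u m := smul (smul (ypow N k) m) (xpow N l) in
  fequiv (E N ** fmap u s ** E N) (E N ** fmap u (frestr (fun m => acts N m l k) s)).
Proof.
move=> u; apply: S_faithful => k' l' g.
have sN : {subset enum N <= [set: 'I_n]} by move=> i; rewrite inE.
rewrite psi_Er // !psi_El // /psi !ev_map ev_restr.
case Hk: (all (fun i => k' i == 0%N) (enum N)); rewrite ?if_same //.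
rewrite -ev_if; apply: eq_ev => m; rewrite !all_enum_set /= in Hk *.
rewrite !pCT.
have if_and (b c : bool) (x : K) :
  (if b then (if c then x else 0) else 0) = if b && c then x else 0 by case: b.
rewrite !if_and; congr (if _ then _ else _).
rewrite /acts -!forall_andb; apply: eq_forallb => i; rewrite inE /= !ffunE.
move/forallP/(_ i): Hk; case: (i \in N) => //=.
by rewrite /actc /bmul; case: (m i) => ? ? /=; lia.
Qed.

Lemma Phi_contraction k l s : p s -> contraction (Phi N k l s).
Proof.
move=> ps; split; first exact: Phi_supp.
pose u m := smul (smul (ypow N k) m) (xpow N l).
pose s' := frestr (fun m => acts N m l k) s.
have pu : p (fmap u s).
  apply: (ideal_eq idp (s := [:: (1, ypow N k)] ** s ** [:: (1, xpow N l)])).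
    apply/fequivP => f; rewrite ev_mul ev_mul ev_cons ev_nil mul1r addr0 ev_map.
    by apply: eq_ev => m; rewrite ev_cons ev_nil mul1r addr0.
  by apply: (ideal_mulr idp) => //; apply: (ideal_mull idp).
have pEu : p (E N ** fmap u s').
  apply: (ideal_eq idp (Eidem_corner k l s)).
  by apply: (ideal_mulr idp) => //; apply: (ideal_mull idp).
(* For the surviving terms y^k m x^l is trivial in the directions of N, hence congruent to the lift
   of its image in L_CN. *)
have C : p (fdiff (fmap (lift N \o pC N) s') (fmap u s')).
  apply: p_cong => x; rewrite mem_filter => /andP[/forallP A _] i /=.
  move: (A i); rewrite /u !ffunE; case: (i \in N) => /=.
    by rewrite /actc /bmul; case: (x.2 i) => ? ? /=; move=> ?; congr (_, _); lia.
  move=> _; rewrite /bmul; case: (x.2 i) => a b /=.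
  by case Ez: (a%:Z - b%:Z) => [?|?] /=; move: Ez; rewrite ?NegzE; lia.
have pEl : p (E N ** fmap (lift N) (Phi N k l s)).
  have := ideal_mull idp (in_subT (E N)) C => {}C.
  apply: (ideal_eq idp _ (ideal_cat idp C pEu)); apply/fequivP => f.
  rewrite ev_cat !ev_mul -ev_add; apply: eq_ev => x.
  by rewrite ev_diff subrK !ev_map.
have [pE|//] := Sprime_elements (fun m => ideal_comm_lift m pEl).
case: (Eidem_notin (enum_uniq N) _ pE) => i.
by rewrite mem_enum => /NP.
Qed.

Lemma lift_mul_cong z z' :
  cong N (lift N (lmul z z')) (smul (lift N z) (lift N z')).
Proof.
move=> i; case iN: (i \in N); first by rewrite !ffunE iN.
rewrite lift_diff ?iN // !ffunE iN /bmul.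
by case: (z i) (z' i) => ? [?|?] /=; rewrite ?NegzE; lia.
Qed.

Lemma lift_mul (a' b' : fsum K (lmon n)) :
  p (fdiff (fmap (lift N) (fmul (@lmul n) a' b'))
           (fmap (lift N) a' ** fmap (lift N) b')).
Proof.
(* Pairs are kept because [fmap_cong] compares two images of one list. *)
pose ab : fsum K (lmon n * lmon n)%type :=
  [seq (x.1 * y.1, (x.2, y.2)) | x <- a', y <- b'].
have := @p_cong _ (fun z => lift N (lmul z.1 z.2))
  (fun z => smul (lift N z.1) (lift N z.2)) ab
  (fun z _ => lift_mul_cong z.2.1 z.2.2).
apply: (ideal_eq idp); apply/fequivP => f; rewrite !ev_diff.
have ev_ab h : ev h ab = ev (fun x => ev (fun y => h (x, y)) b') a'.
  rewrite /ev /ab big_allpairs_dep; apply: eq_bigr => x _ /=.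
  by rewrite mulr_sumr; apply: eq_bigr => y _; rewrite mulrA.
rewrite !ev_map !ev_ab !ev_mul ev_map; congr (_ - _).
by apply: eq_ev => x /=; rewrite ev_map.
Qed.

Lemma contraction_ideal : Lideal N contraction.
Proof.
split; first by move=> t [].
split=> [t u [Nt pt] tu|].
  by split; [exact: in_sub_eq tu Nt | exact: (ideal_eq idp (fmap_eq _ tu) pt)].
split; first by split; [move=> z; rewrite /coef big_nil eqxx | exact: ideal_nil idp].
split=> [t u [Nt pt] [Nu pu]|].
  split; first exact: in_sub_cat.
  by rewrite /fmap map_cat; exact: (ideal_cat idp pt pu).
split=> [c t [Nt pt]|a t Na [Nt pt]].
  split; first exact: in_sub_scale.
  apply: (ideal_eq idp _ (ideal_scale idp c pt)); apply/fequivP => f.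
  by rewrite ev_map !ev_scale ev_map.
split; split; try exact: (in_sub_mul (@Lsupp_mul n _)).
  exact: (ideal_diff idp (lift_mul _ _) (ideal_mull idp (in_subT _) pt)).
exact: (ideal_diff idp (lift_mul _ _) (ideal_mulr idp (in_subT _) pt)).
Qed.

Lemma contraction_prime : Lprime (~: N) contraction.
Proof.
split; first exact: contraction_ideal.
split.
  exists [:: (1, lone n)]; split=> [|[_ p1]].
    by apply: in_sub_all => x; rewrite inE => /eqP ->; exact: Lsupp1.
  apply: Sprime_unit; suff <- : lift N (lone n) = sone n by [].
  by apply/ffunP => i; rewrite !ffunE if_same.
move=> J1 J2 iJ1 iJ2 J12; apply: NNPP => /not_or_and[Ha Hb].
have [a Ha'] := not_all_ex_not _ _ Ha; have [J1a na] := imply_to_and _ _ Ha'.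
have [b Hb'] := not_all_ex_not _ _ Hb; have [J2b nb] := imply_to_and _ _ Hb'.
have [_ pab] := J12 _ _ J1a J2b.
have {}pab := ideal_diff idp (diff_sym idp (lift_mul a b)) pab.
have [pa|pb] := Sprime_elements (fun m => ideal_comm_lift m pab).
  by apply: na; split=> //; exact: (ideal_sub iJ1).
by apply: nb; split=> //; exact: (ideal_sub iJ2).
Qed.

(** For the converse inclusion, modulo p the element s is the sum, over the monomials v of S_N, of v
    times the lift of the slice of s at v. *)
Lemma Spart_contraction s : p s <-> Spart N contraction s.
Proof.
rewrite (SpartP _ contraction_ideal); split=> [ps k l|].
  exact: Phi_contraction.
move/(slices_of_Phi contraction_ideal) => H.
have: p (fmap id (frestr (predT \o restr N) s)).
  apply: fibre_sum => [t u| |t u|m _].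
  - exact: (ideal_eq idp).
  - exact: (ideal_nil idp).
  - exact: (ideal_cat idp).
  set t := frestr _ s; have [_ pm] := H m.
  have C : p (fdiff (fmap id t) (fmap (fun x => smul (restr N m) (lift N (pC N x))) t)).
    apply: p_cong => x; rewrite mem_filter => /andP[/eqP rx _] i /=.
    have /(congr1 (fun u : smon n => u i)) := rx; rewrite !ffunE.
    case: (i \in N) => [<-|_]; rewrite /bmul; case: (x.2 i) => c d /=.
      by congr (_, _); lia.
    by case Ez: (c%:Z - d%:Z) => [?|?] /=; move: Ez; rewrite ?NegzE; lia.
  apply: (ideal_diff idp C).
  apply: (ideal_eq idp _ (ideal_mull idp (in_subT [:: (1, restr N m)]) pm)).
  by apply/fequivP => f; rewrite ev_mul ev_cons ev_nil mul1r addr0 !ev_map.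
apply: (ideal_eq idp); apply/fequivP => f; rewrite ev_map ev_restr.
exact: eq_ev.
Qed.

End PrimeIdeal.

(** Both N and q are expressed through p alone, so two presentations of p agree. *)
Lemma Spart_unique (p : fsum K (smon n) -> Prop) N q : Lprime (~: N) q ->
  (forall s, p s <-> Spart N q s) ->
  (forall i, i \in N <-> ~ p (eps K i)) /\
  (forall t, q t <-> in_sub (Lsupp (~: N)) t /\ p (fmap (lift N) t)).
Proof.
move=> prq pS; split=> [i|t].
  rewrite pS Spart_eps //; split=> [->//|/negP]; by rewrite negbK.
split=> [qt|[Nt]]; last by rewrite pS Spart_lift.
have Nt := ideal_sub (proj1 prq) qt.
by split=> //; rewrite pS Spart_lift.
Qed.

End PrimeSpectrum.

(** Membership in p is a proposition, not a boolean, so the set is built along the enumeration, with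
    excluded middle at each element. *)
Lemma finite_comprehension (T : finType) (A : T -> Prop) :
  exists N : {set T}, forall i, i \in N <-> A i.
Proof.
suff [N HN] : exists N : {set T}, forall i, i \in N <-> i \in enum T /\ A i.
  by exists N => i; rewrite HN mem_enum; split=> [[]|].
elim: (enum T) => [|x r [N HN]]; first by exists set0 => i; rewrite inE; split=> // -[].
have [Ax|nAx] := classic (A x).
  exists (x |: N) => i; rewrite in_setU1 inE.
  by case: eqP => [->|_] /=; [split | rewrite HN].
exists N => i; rewrite inE HN; case: eqP => [->|_] //=.
by split=> [[]|[]].
Qed.

Theorem theorem4p4 (K : fieldType) (n : nat) : (0 < n)%N ->
  (forall p : fsum K (smon n) -> Prop, Sprime p ->
     exists N : {set 'I_n}, exists q : fsum K (lmon n) -> Prop,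
       Lprime (~: N) q /\ (forall s, p s <-> Spart N q s) /\
       (forall (N' : {set 'I_n}) (q' : fsum K (lmon n) -> Prop),
          Lprime (~: N') q' -> (forall s, p s <-> Spart N' q' s) ->
          N' = N /\ (forall t, q' t <-> q t))) /\
  (forall (N : {set 'I_n}) (q : fsum K (lmon n) -> Prop),
     Lprime (~: N) q -> Sprime (Spart N q)).
Proof.
move=> _; split=> [p prp|N q]; last exact: Spart_prime.
have [N NP] := finite_comprehension (fun i => ~ p (eps K i)).
exists N, (contraction p N); split; first exact: contraction_prime.
split=> [s|N' q' prq' pS']; first exact: Spart_contraction.
have [NP' qP] := Spart_unique prq' pS'.
have NN : N' = N by apply/setP => i; apply/idP/idP => [/NP'/NP|/NP/NP'].
by split=> // t; rewrite qP NN.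
Qed.
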